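(* Let $f\in\mathbb{Z}[\mathbb{H}]$. Then the principal algebraic $\mathbb{H}$-action $\alpha_f$ on $X_f$ is expansive if and only if there exists a constant $c>0$ such that for every finite-dimensional irreducible unitary representation $\pi$ of $\mathbb{H}$ the operator $\pi(f)$ is invertible and $\|\pi(f)^{-1}\|\le c$.
   Context: $\mathbb{H}$ is the discrete Heisenberg group of upper triangular unipotent $3\times3$ integer matrices. $\mathbb{Z}[\mathbb{H}]$ is the integer group ring (finitely supported functions $f=\sum_\gamma f_\gamma\cdot\gamma$ with $f_\gamma\in\mathbb{Z}$). A unitary representation $\pi$ extends to the group ring by $\pi(f)=\sum_\gamma f_\gamma\pi(\gamma)$. Let $\mathbb{T}=\mathbb{R}/\mathbb{Z}$ and $$X_f=\Bigl\{x\in\mathbb{T}^{\mathbb{H}}:\ \sum_{\gamma\in\mathbb{H}}f_\gamma x_{\gamma'\gamma}=0\ \text{for every }\gamma'\in\mathbb{H}\Bigr\},$$ a compact abelian group; $\alpha_f$ is the restriction to $X_f$ of the left shift action $(\lambda^\gamma x)_{\gamma'}=x_{\gamma^{-1}\gamma'}$ on $\mathbb{T}^{\mathbb{H}}$. An action $\alpha$ of a countable group $\Gamma$ by automorphisms of a compact metrisable abelian group $X$, with translation invariant (compatible) metric $d$, is expansive if there is $\varepsilon>0$ such that $\sup_{\gamma\in\Gamma}d(\alpha^\gamma x,\alpha^\gamma y)>\varepsilon$ for all distinct $x,y\in X$. *)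

(* Defs.v *)
From HB Require Import structures.
From mathcomp Require Import all_boot all_order all_algebra finmap.
From mathcomp Require Import archimedean ring_quotient spectral.
From mathcomp Require Import boolp classical_sets functions reals.
From mathcomp Require Import constructive_ereal ereal.
From mathcomp Require Import topology.
From mathcomp Require Import complex.

Set Implicit Arguments.
Unset Strict Implicit.
Unset Printing Implicit Defensive.

Import Order.TTheory GRing.Theory Num.Theory.
Import numFieldTopology.Exports.

Local Open Scope classical_set_scope.
Local Open Scope ring_scope.

(* [is_trig_mx] means lower triangular, hence the transpose. *)
Definition is_unipotent_upper n (A : 'M[int]_n) : bool :=
  is_trig_mx A^T && [forall i, A i i == 1].

Record heisenberg := Heisenberg {
  heis_mx :> 'M[int]_3;
  heis_mxP : is_unipotent_upper heis_mx
}.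

HB.instance Definition _ := [isSub for heis_mx].
HB.instance Definition _ := [Choice of heisenberg by <:].

Section UnipotentUpper.

Lemma is_unipotent_upperP n (A : 'M[int]_n) :
  reflect (forall i j : 'I_n, (j <= i)%N -> A i j = (i == j)%:R)
          (is_unipotent_upper A).
Proof.
apply: (iffP andP) => [[/is_trig_mxP trA /forallP dA] i j | AE].
  rewrite leq_eqVlt => /orP[/eqP/val_inj-> | lt_ji].
    by rewrite eqxx; apply/eqP.
  have := trA j i lt_ji; rewrite mxE => ->.
  by case: eqVneq lt_ji => // ->; rewrite ltnn.
split; first apply/is_trig_mxP => i j lt_ij.
  rewrite mxE AE ?(ltnW lt_ij) //.
  by case: eqVneq lt_ij => // ->; rewrite ltnn.
by apply/forallP => i; rewrite AE ?eqxx.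
Qed.

Lemma unipotent_upper1 n : is_unipotent_upper (1%:M : 'M[int]_n).
Proof. by apply/is_unipotent_upperP => i j _; rewrite mxE. Qed.

Lemma unipotent_upperM n (A B : 'M[int]_n) :
  is_unipotent_upper A -> is_unipotent_upper B -> is_unipotent_upper (A *m B).
Proof.
move=> /is_unipotent_upperP AE /is_unipotent_upperP BE.
apply/is_unipotent_upperP => i j le_ji; rewrite mxE (bigD1 i) //= big1 ?addr0.
  by rewrite AE // eqxx mul1r BE.
move=> k ne_ki; have [lt_ki | le_ik] := ltnP k i.
  by rewrite AE 1?ltnW // eq_sym (negPf ne_ki) mul0r.
rewrite [B k j]BE ?(leq_trans le_ji) //.
suff /negPf-> : k != j by rewrite mulr0.
apply: contraNneq ne_ki => kj; rewrite -val_eqE /= eqn_leq le_ik andbT.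
by rewrite kj.
Qed.

Lemma unipotent_upper_inv (A : 'M[int]_3) : is_unipotent_upper A ->
  A \in unitmx /\ is_unipotent_upper (invmx A).
Proof.
move=> /is_unipotent_upperP AE.
pose N : 'M[int]_3 := A - 1%:M.
have NE (i j : 'I_3) : (j <= i)%N -> N i j = 0.
  by move=> le_ji; rewrite !mxE AE // subrr.
have defA : A = N + 1%:M by rewrite subrK.
clearbody N.
have N2E (i j : 'I_3) : (j <= i.+1)%N -> (N *m N) i j = 0.
  move=> le_ji; rewrite mxE big1 // => k _.
  have [le_ki | lt_ik] := leqP k i; first by rewrite NE ?mul0r.
  by rewrite [N k j]NE ?mulr0 // (leq_trans le_ji).
have N3 : N *m (N *m N) = 0.
  apply/matrixP => i j; rewrite !mxE big1 // => k _.
  have [le_ki | lt_ik] := leqP k i; first by rewrite NE ?mul0r.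
  rewrite N2E ?mulr0 // -ltnS (leq_trans (ltn_ord j)) // !ltnS.
  exact: leq_ltn_trans lt_ik.
pose B : 'M[int]_3 := 1%:M - N + N *m N.
have AB : A *m B = 1%:M.
  rewrite defA mulmxDl mul1mx /B !mulmxDr mulmxN mulmx1 N3.
  by rewrite addr0 addrC addrACA subrr addr0 subrK.
have [unitA _] := mulmx1_unit AB; split=> //.
have -> : invmx A = B by rewrite -[RHS](mulKmx unitA) AB mulmx1.
apply/is_unipotent_upperP => i j le_ji.
rewrite /B mxE N2E ?(leq_trans le_ji) // addr0.
by rewrite mxE [(- N) i j]mxE NE // subr0 mxE.
Qed.

End UnipotentUpper.

Section HeisenbergGroup.
Implicit Types x y z : heisenberg.

Definition heis_one : heisenberg := Heisenberg (unipotent_upper1 3).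
Definition heis_mul x y : heisenberg :=
  Heisenberg (unipotent_upperM (heis_mxP x) (heis_mxP y)).
Definition heis_inv x : heisenberg :=
  Heisenberg (unipotent_upper_inv (heis_mxP x)).2.

Lemma heis_mulA : associative heis_mul.
Proof. by move=> x y z; apply: val_inj; rewrite /= mulmxA. Qed.

Lemma heis_mul1g : left_id heis_one heis_mul.
Proof. by move=> x; apply: val_inj; rewrite /= mul1mx. Qed.

Lemma heis_mulg1 : right_id heis_one heis_mul.
Proof. by move=> x; apply: val_inj; rewrite /= mulmx1. Qed.

Lemma heis_mulVg : left_inverse heis_one heis_inv heis_mul.
Proof.
move=> x; apply: val_inj => /=.
by rewrite mulVmx // (unipotent_upper_inv (heis_mxP x)).1.
Qed.

Lemma heis_mulgV : right_inverse heis_one heis_inv heis_mul.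
Proof.
move=> x; apply: val_inj => /=.
by rewrite mulmxV // (unipotent_upper_inv (heis_mxP x)).1.
Qed.

End HeisenbergGroup.

HB.instance Definition _ := isGroup.Build heisenberg
  heis_mulA heis_mul1g heis_mulg1 heis_mulVg heis_mulgV.

Definition integer_group_ring (G : groupType) : Type :=
  {fsfun G -> int with 0}.

Section Torus.
Variable R : realType.

Definition integers : {pred R} := [pred x | x \is a Num.int].

Lemma integers_zmod_closed : zmod_closed integers.
Proof. by split=> [|x y]; rewrite !inE ?rpred0 //; apply: rpredB. Qed.

HB.instance Definition _ :=
  GRing.isZmodClosed.Build R integers integers_zmod_closed.

(* {ideal_quot _} is used here only as the quotient of an additive group by a  *)
(* subgroup.                                                                   *)
Definition torus : Type := quotient_topology {ideal_quot integers}.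

HB.instance Definition _ :=
  Topological.copy torus (quotient_topology {ideal_quot integers}).
HB.instance Definition _ := GRing.isZmodule.Build torus
  (@Quotient.addqA R integers) (@Quotient.addqC R integers)
  (@Quotient.add0q R integers) (@Quotient.addNq R integers).

End Torus.

Section PrincipalAction.
Variables (R : realType) (G : groupType) (f : integer_group_ring G).

Definition principal_set : set {ptws G -> torus R} :=
  [set x | forall h : G, \sum_(g <- finsupp f) x (h * g)%g *~ f g = 0].

Lemma principal_set_zmod_closed :
  zmod_closed (fun x : {ptws G -> torus R} => x \in principal_set).
Proof.
split=> [|x y].
  by rewrite unfold_in; apply/mem_set => h; rewrite big1 // => g _; rewrite mul0rz.
rewrite !unfold_in => /set_mem xX /set_mem yX; apply/mem_set => h.
under eq_bigr => g _ do rewrite /= mulrzBl.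
by rewrite sumrB xX yX subr0.
Qed.

Definition principal_space : Type := set_type principal_set.

HB.instance Definition _ :=
  Topological.copy principal_space (set_type principal_set).
HB.instance Definition _ := SubType.copy principal_space
  (set_type principal_set).
HB.instance Definition _ := GRing.SubChoice_isSubZmodule.Build
  {ptws G -> torus R} (fun x => x \in principal_set) principal_space
  principal_set_zmod_closed.

Definition left_shift (g : G) (x : {ptws G -> torus R}) :
    {ptws G -> torus R} :=
  fun h => x (g^-1 * h)%g.

Lemma principal_set_left_shift (g : G) (x : principal_space) :
  left_shift g (val x) \in principal_set.
Proof.
apply/mem_set => h; have /set_mem/(_ (g^-1 * h)%g) := valP x.
by under eq_bigr => k _ do rewrite -mulgA.
Qed.

Definition principal_action (g : G) (x : principal_space) : principal_space :=
  Sub (left_shift g (val x)) (principal_set_left_shift g x).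

End PrincipalAction.

Section Expansive.
Variable R : realType.

Record compatible_metric (X : topologicalType) (d : X -> X -> R) : Prop := {
  cmetric_eq0 : forall x y, d x y = 0 <-> x = y;
  cmetricC : forall x y, d x y = d y x;
  cmetric_triangle : forall x y z, d x z <= d x y + d y z;
  cmetric_nbhs : forall (x : X) (A : set X),
    nbhs x A <-> exists2 e : R, 0 < e & [set y | d x y < e] `<=` A
}.

Definition translation_invariant (X : zmodType) (d : X -> X -> R) : Prop :=
  forall x y z, d (x + z) (y + z) = d x y.

(* The supremum is taken in the extended reals, where it always exists. *)
Definition expansive (G X : Type) (alpha : G -> X -> X) (d : X -> X -> R) :
    Prop :=
  exists2 e : R, 0 < e & forall x y : X, x <> y ->
    (e%:E < ereal_sup [set (d (alpha g x) (alpha g y))%:E | g in [set: G]])%E.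

End Expansive.

Section Representations.
Variable R : realType.

Definition euclidean_norm (n : nat) (v : 'cV[R[i]]_n) : R :=
  Num.sqrt (\sum_(i < n) (complex.Re (v i 0) ^+ 2 + complex.Im (v i 0) ^+ 2)).

Definition operator_norm (n : nat) (A : 'M[R[i]]_n) : R :=
  sup [set euclidean_norm (A *m v) | v in [set v | euclidean_norm v <= 1]].

Variable G : groupType.

Definition unitary_representation (n : nat) (pi : G -> 'M[R[i]]_n) : Prop :=
  (forall g h, pi (g * h)%g = pi g *m pi h) /\ (forall g, pi g \is unitarymx).

(* Matrices act on column vectors, whereas subspaces are row spaces in the    *)
(* library: the row space of U stands for the columns v with v^T in it, and   *)
(* A *m v^T = (v *m A^T)^T.                                                   *)
Definition irreducible (n : nat) (pi : G -> 'M[R[i]]_n) : Prop :=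
  (0 < n)%N /\ forall U : 'M[R[i]]_n, (forall g, stablemx U (pi g)^T) ->
    (U == 0 \/ row_full U).

Definition group_ring_rep (n : nat) (pi : G -> 'M[R[i]]_n)
    (f : integer_group_ring G) : 'M[R[i]]_n :=
  \sum_(g <- finsupp f) (f g)%:~R *: pi g.

End Representations.

(* Main.v *)
Require Import Defs.
From HB Require Import structures.
From mathcomp Require Import all_boot all_order all_algebra finmap.
From mathcomp Require Import spectral ring lra zify.
From mathcomp Require Import boolp classical_sets functions reals.
From mathcomp Require Import ereal topology normedtype complex.

(* Write rho(f)w for the function h |-> sum_g f_g w(hg). Lifting points of    *)
(* X_f with small coordinates to R shows that alpha_f is expansive iff no     *)
(* nonzero bounded real w satisfies rho(f)w = 0.                              *)
(*   If the inverses pi(f)^-1 are not uniformly bounded, then matrix          *)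
(* coefficients w(h) = Re <pi(h)v, v> / |v|^2 with pi(f)v almost 0 satisfy    *)
(* w(1) = 1, |w| <= 1 and rho(f)w ~ 0 uniformly, and a pointwise limit of     *)
(* such w is a nonzero bounded solution of rho(f)w = 0.                       *)
(*   Conversely, a bound c on |pi(f)^-1| over irreducible pi gives            *)
(* |v| <= c |pi(f)v| for all finite-dimensional unitary pi, in particular for *)
(* the permutation representations on the Heisenberg groups mod N; since a    *)
(* finite subset of H embeds in such a quotient, |v|_2 <= c |rho(f)v|_2 for   *)
(* every finitely supported v on H. Let w be bounded with rho(f)w = 0, and    *)
(* let a_r be the sum of w^2 over a box B_r. Cutting w off at B_(r+2) yields  *)
(* a_(r+2) <= D (a_(r+2) - a_r), hence exponential growth of a_r unless w is  *)
(* 0 at the centre of the boxes, whereas |B_r| grows polynomially. This       *)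
(* replaces the Wiener lemma for l^1(H).                                      *)

Set Implicit Arguments.
Unset Strict Implicit.
Unset Printing Implicit Defensive.

Import Order.TTheory GRing.Theory Num.Theory.
Import numFieldTopology.Exports numFieldNormedType.Exports.

Local Open Scope ring_scope.

(** * Norms of complex vectors *)

Section ComplexVectors.
Local Open Scope sesquilinear_scope.
Variable R : realType.
Implicit Types (m n : nat).

Definition re_dot n (u v : 'cV[R[i]]_n) : R :=
  \sum_i (complex.Re (u i 0) * complex.Re (v i 0) +
          complex.Im (u i 0) * complex.Im (v i 0)).

Definition sq_norm n (v : 'cV[R[i]]_n) : R := re_dot v v.

Lemma ReD (x y : R[i]) : complex.Re (x + y) = complex.Re x + complex.Re y.
Proof. by case: x; case: y. Qed.

Lemma ImD (x y : R[i]) : complex.Im (x + y) = complex.Im x + complex.Im y.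
Proof. by case: x; case: y. Qed.

Lemma Re_sum (I : Type) (r : seq I) (F : I -> R[i]) :
  complex.Re (\sum_(i <- r) F i) = \sum_(i <- r) complex.Re (F i).
Proof. exact: (big_morph (@complex.Re R) ReD). Qed.

Lemma Im_sum (I : Type) (r : seq I) (F : I -> R[i]) :
  complex.Im (\sum_(i <- r) F i) = \sum_(i <- r) complex.Im (F i).
Proof. exact: (big_morph (@complex.Im R) ImD). Qed.

Lemma complex_intr (k : int) : (k%:~R : R[i]) = (k%:~R : R)%:C%C.
Proof. by rewrite rmorph_int. Qed.

Lemma euclidean_normE n (v : 'cV[R[i]]_n) :
  euclidean_norm v = Num.sqrt (sq_norm v).
Proof. by congr Num.sqrt; apply: eq_bigr => i _; rewrite !expr2. Qed.

Lemma sq_norm_ge0 n (v : 'cV[R[i]]_n) : 0 <= sq_norm v.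
Proof. by apply: sumr_ge0 => i _; rewrite addr_ge0 // -expr2 sqr_ge0. Qed.

Lemma sq_norm0 n : sq_norm (0 : 'cV[R[i]]_n) = 0.
Proof. by rewrite /sq_norm /re_dot big1 // => i _; rewrite mxE /= mulr0 addr0. Qed.

Lemma sq_norm_eq0 n (v : 'cV[R[i]]_n) : (sq_norm v == 0) = (v == 0).
Proof.
apply/eqP/eqP => [v0 | ->]; last exact: sq_norm0.
apply/colP => i; rewrite mxE; apply/eqP; rewrite eq_complex /=.
have ge0 (j : 'I_n) : true -> 0 <= complex.Re (v j 0) * complex.Re (v j 0) +
          complex.Im (v j 0) * complex.Im (v j 0).
  by move=> _; rewrite addr_ge0 // -expr2 sqr_ge0.
have /eqP := psumr_eq0P ge0 v0 (i := i) isT.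
by rewrite paddr_eq0 -?expr2 ?sqr_ge0 // !sqrf_eq0.
Qed.

Lemma sq_normE m (v : 'cV[R[i]]_m) : (sq_norm v)%:C%C = (v^t* *m v) 0 0.
Proof.
rewrite mxE rmorph_sum; apply: eq_bigr => i _; rewrite !mxE.
case: (v i 0) => a b /=; apply/eqP; rewrite eq_complex /=.
by apply/andP; split; apply/eqP; ring.
Qed.

Lemma sq_norm_isometry m n (A : 'M[R[i]]_(m, n)) (v : 'cV[R[i]]_n) :
  A^t* *m A = 1%:M -> sq_norm (A *m v) = sq_norm v.
Proof.
move=> A1; apply: (@complexI R); rewrite !sq_normE trmx_mul map_mxM.
by rewrite mulmxA -[_ *m _ *m A]mulmxA A1 mulmx1.
Qed.

Lemma sq_norm_unitary n (A : 'M[R[i]]_n) (v : 'cV[R[i]]_n) :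
  A \is unitarymx -> sq_norm (A *m v) = sq_norm v.
Proof.
rewrite -trmxC_unitary => /unitarymxP A1; apply: sq_norm_isometry.
by move: A1; rewrite trmxCK.
Qed.

Lemma sq_norm_col_mx m n (u : 'cV[R[i]]_m) (v : 'cV[R[i]]_n) :
  sq_norm (col_mx u v) = sq_norm u + sq_norm v.
Proof.
rewrite /sq_norm /re_dot big_split_ord /=; congr (_ + _);
  by apply: eq_bigr => i _; rewrite ?col_mxEu ?col_mxEd.
Qed.

Lemma re_dotMr n (u v : 'cV[R[i]]_n) (k : int) :
  re_dot u (k%:~R *: v) = k%:~R * re_dot u v.
Proof.
rewrite /re_dot mulr_sumr; apply: eq_bigr => i _; rewrite mxE complex_intr.
by case: (v i 0) => a b /=; ring.
Qed.

Lemma re_dotZl n (u v : 'cV[R[i]]_n) (k : R) :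
  re_dot (k%:C%C *: u) v = k * re_dot u v.
Proof.
rewrite /re_dot mulr_sumr; apply: eq_bigr => i _; rewrite mxE.
by case: (u i 0) => a b /=; ring.
Qed.

Lemma re_dotC n (u v : 'cV[R[i]]_n) : re_dot u v = re_dot v u.
Proof. by apply: eq_bigr => i _; congr (_ + _); rewrite mulrC. Qed.

Lemma re_dot0r n (u : 'cV[R[i]]_n) : re_dot u 0 = 0.
Proof. by rewrite /re_dot big1 // => i _; rewrite mxE /= !mulr0 addr0. Qed.

Lemma re_dotDr n (u v w : 'cV[R[i]]_n) :
  re_dot u (v + w) = re_dot u v + re_dot u w.
Proof.
rewrite /re_dot -big_split; apply: eq_bigr => i _ /=; rewrite mxE ReD ImD.
by ring.
Qed.

Lemma re_dot_sumr n (u : 'cV[R[i]]_n) (I : Type) (r : seq I)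
    (F : I -> 'cV[R[i]]_n) :
  re_dot u (\sum_(i <- r) F i) = \sum_(i <- r) re_dot u (F i).
Proof. exact: (big_morph (re_dot u) (re_dotDr u) (re_dot0r u)). Qed.

Lemma sq_normZ n (k : R) (v : 'cV[R[i]]_n) :
  sq_norm (k%:C%C *: v) = k ^+ 2 * sq_norm v.
Proof. by rewrite /sq_norm re_dotZl re_dotC re_dotZl mulrA expr2. Qed.

(** A weighted form of Cauchy-Schwarz without square roots: the squared norms of [u + s^-1 v] and
    [u - s^-1 v] are nonnegative. The free weight [s] is used to balance a large and a small
    vector. *)
Lemma re_dot_le n (u v : 'cV[R[i]]_n) (s : R) : 0 < s ->
  `|re_dot u v| <= (s * sq_norm u + s^-1 * sq_norm v) / 2.
Proof.
move=> s_gt0; rewrite ler_pdivlMr // (le_trans (ler_wpM2r _ (ler_norm_sum _ _ _))) //.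
rewrite mulr_suml !mulr_sumr -big_split ler_sum //= => i _.
rewrite -[2]ger0_norm // -normrM ler_norml.
set a := complex.Re _; set b := complex.Im _.
set c := complex.Re _; set d := complex.Im _.
have -> : s * (a * a + b * b) + s^-1 * (c * c + d * d) =
    s * ((a - s^-1 * c) ^+ 2 + (b - s^-1 * d) ^+ 2) + (a * c + b * d) * 2.
  by field; rewrite gt_eqF.
apply/andP; split; last by rewrite lerDr mulr_ge0 ?addr_ge0 ?sqr_ge0 1?ltW.
rewrite lerNl -subr_ge0 opprK.
have -> : s * ((a - s^-1 * c) ^+ 2 + (b - s^-1 * d) ^+ 2) + (a * c + b * d) * 2
   + (a * c + b * d) * 2 = s * ((a + s^-1 * c) ^+ 2 + (b + s^-1 * d) ^+ 2).
  by field; rewrite gt_eqF.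
by rewrite mulr_ge0 ?addr_ge0 ?sqr_ge0 1?ltW.
Qed.

Lemma Re_Im_mul_le (x y : R[i]) :
  `|complex.Re y| <= 1 -> `|complex.Im y| <= 1 ->
  `|complex.Re (x * y)| <= `|complex.Re x| + `|complex.Im x| /\
  `|complex.Im (x * y)| <= `|complex.Re x| + `|complex.Im x|.
Proof.
case: x => a b; case: y => u w /= u1 w1.
have le1 (z t : R) : `|t| <= 1 -> `|z * t| <= `|z|.
  by move=> t1; rewrite normrM ler_piMr.
split; first by apply: le_trans (ler_normB _ _) _; apply: lerD; apply: le1.
by apply: le_trans (ler_normD _ _) _; apply: lerD; apply: le1.
Qed.

(** Provides the upper bound that [ub_le_sup] needs in order to compare a value with the supremum in
    [operator_norm]. *)
Lemma mulmx_bounded m n (A : 'M[R[i]]_(m, n)) :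
  exists K : R, forall v, sq_norm v <= 1 -> sq_norm (A *m v) <= K.
Proof.
pose k i : R := \sum_j (`|complex.Re (A i j)| + `|complex.Im (A i j)|).
exists (\sum_i (k i ^+ 2 + k i ^+ 2)) => v v1; apply: ler_sum => i _.
have coord (j : 'I_n) : `|complex.Re (v j 0)| <= 1 /\ `|complex.Im (v j 0)| <= 1.
  have le_sq (x y : R) : x * x + y * y <= 1 -> `|x| <= 1.
    move=> xy; rewrite -(@ler_pXn2r _ 2) ?nnegrE // real_normK ?num_real //.
    by rewrite expr1n (le_trans _ xy) // expr2 lerDl -expr2 sqr_ge0.
  suff jle : complex.Re (v j 0) * complex.Re (v j 0) +
            complex.Im (v j 0) * complex.Im (v j 0) <= 1.
    by split; apply: le_sq; first exact: jle; rewrite addrC; exact: jle.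
  apply: le_trans v1; rewrite /sq_norm /re_dot (bigD1 j) //= lerDl.
  by apply: sumr_ge0 => l _; rewrite addr_ge0 // -expr2 sqr_ge0.
have k_ge0 : 0 <= k i by apply: sumr_ge0 => j _; rewrite addr_ge0.
have bnd (x : R) : `|x| <= k i -> x * x <= k i ^+ 2.
  move=> xk; rewrite -expr2 -real_normK ?num_real //.
  by apply: lerXn2r; rewrite ?nnegrE.
rewrite !mxE Re_sum Im_sum; apply: lerD; apply: bnd;
  apply: le_trans (ler_norm_sum _ _ _) _; apply: ler_sum => j _;
  by have [? ?] := coord j; have [] := @Re_Im_mul_le (A i j) (v j 0).
Qed.

(** Being bounded below forces a square matrix to be injective, hence invertible. The right-hand
    side mentions no inverse, and in this form the bound passes to orthogonal sums with the same
    constant. *)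
Lemma operator_norm_invmxP n (A : 'M[R[i]]_n) (c : R) : 0 < c ->
  (A \in unitmx /\ operator_norm (invmx A) <= c) <->
  (forall v, sq_norm v <= c ^+ 2 * sq_norm (A *m v)).
Proof.
move=> c_gt0; split=> [[Aunit Ac] v | Ac].
  have [-> | v_neq0] := eqVneq v 0; first by rewrite mulmx0 sq_norm0 mulr0.
  have {v v_neq0} [u -> u_neq0] : exists2 u, v = invmx A *m u & u != 0.
    exists (A *m v); first by rewrite mulKmx.
    by apply: contraNneq v_neq0 => Av; rewrite -(mulKmx Aunit v) Av mulmx0.
  rewrite mulKVmx //.
  have u_gt0 : 0 < sq_norm u by rewrite lt_def sq_norm_ge0 sq_norm_eq0 u_neq0.
  pose k := (Num.sqrt (sq_norm u))^-1.
  have k2 : k ^+ 2 = (sq_norm u)^-1 by rewrite exprVn sqr_sqrtr ?sq_norm_ge0.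
  have: euclidean_norm (invmx A *m (k%:C%C *: u)) <= c.
    apply: le_trans Ac; apply: ub_le_sup.
      have [K KP] := mulmx_bounded (invmx A).
      exists (Num.sqrt K) => _ [v /= v1 <-]; rewrite euclidean_normE ler_wsqrtr //.
      by apply: KP; move: v1; rewrite euclidean_normE -{1}sqrtr1 ler_sqrt.
    exists (k%:C%C *: u) => //=.
    by rewrite euclidean_normE sq_normZ k2 mulVf ?gt_eqF // sqrtr1.
  rewrite euclidean_normE -scalemxAr sq_normZ k2 => le_c.
  have: (sq_norm u)^-1 * sq_norm (invmx A *m u) <= c ^+ 2.
    rewrite -[leLHS]sqr_sqrtr ?mulr_ge0 ?invr_ge0 ?sq_norm_ge0 //.
    by rewrite lerXn2r ?nnegrE ?sqrtr_ge0 // ltW.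
  by rewrite mulrC ler_pdivrMr.
have Aunit : A \in unitmx.
  rewrite -unitmx_tr -row_free_unit -kermx_eq0; apply/rowV0P => u /sub_kermxP uA.
  apply/eqP; rewrite -trmx_eq0 -sq_norm_eq0 eq_le sq_norm_ge0 andbT.
  apply: le_trans (Ac _) _; rewrite -[A]trmxK -trmx_mul uA trmx0 sq_norm0.
  by rewrite mulr0.
split=> //; apply: ge_sup => [| _ [v /= v1 <-]].
  exists (euclidean_norm (invmx A *m 0)), 0 => //=.
  by rewrite euclidean_normE sq_norm0 sqrtr0.
rewrite euclidean_normE -[c](ger0_norm (ltW c_gt0)) -sqrtr_sqr ler_wsqrtr //.
apply: le_trans (Ac _) _; rewrite mulKVmx // ler_piMr ?sqr_ge0 //.
by move: v1; rewrite euclidean_normE -{1}sqrtr1 ler_sqrt.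
Qed.

End ComplexVectors.

(** * Reduction to irreducible representations *)

Section CompleteReducibility.
Local Open Scope sesquilinear_scope.
Variables (R : realType) (G : groupType).

Lemma trmxC_mul m n p (A : 'M[R[i]]_(m, n)) (B : 'M[R[i]]_(n, p)) :
  (A *m B)^t* = B^t* *m A^t*.
Proof. by rewrite trmx_mul map_mxM. Qed.

Lemma unitary_representation1 n (pi : G -> 'M[R[i]]_n) :
  unitary_representation pi -> pi 1%g = 1%:M.
Proof.
move=> [piM piU]; have /unitarymx_unit pi1 := piU 1%g.
by rewrite -(mulVmx pi1) -{3}(mulg1 1%g) piM mulKmx.
Qed.

Lemma unitary_representationV n (pi : G -> 'M[R[i]]_n) g :
  unitary_representation pi -> pi g^-1%g = (pi g)^t*.
Proof.
move=> pirep; have [piM piU] := pirep.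
have /unitarymxP piV := piU g.
rewrite -[RHS]mul1mx -(unitary_representation1 pirep) -(mulVg g) piM.
by rewrite -mulmxA piV mulmx1.
Qed.

Lemma sum_block_diag_mx (I : Type) (r : seq I) m n (F : I -> 'M[R[i]]_m)
    (H : I -> 'M[R[i]]_n) (k : I -> R[i]) :
  \sum_(i <- r) k i *: block_mx (F i) 0 0 (H i) =
  block_mx (\sum_(i <- r) k i *: F i) 0 0 (\sum_(i <- r) k i *: H i).
Proof.
elim: r => [|i r IHr]; first by rewrite !big_nil block_mx0.
by rewrite !big_cons IHr scale_block_mx add_block_mx !scaler0 !addr0.
Qed.

Section BlockDiagonal.
Variables (n p q : nat) (pi : G -> 'M[R[i]]_n) (J : 'M[R[i]]_(n, p + q)).
Variables (s : G -> 'M[R[i]]_p) (t : G -> 'M[R[i]]_q).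
Hypothesis pirep : unitary_representation pi.
Hypothesis JJV : J *m J^t* = 1%:M.
Hypothesis JVJ : J^t* *m J = 1%:M.
Hypothesis piJ : forall g, J^t* *m pi g *m J = block_mx (s g) 0 0 (t g).

(** Products are read off the diagonal blocks. For unitarity, the blocks of [pi g^-1], which is the
    adjoint of [pi g], are the adjoints of [s g] and [t g]. *)
Lemma block_diag_unitary_representation :
  unitary_representation s /\ unitary_representation t.
Proof.
have blockM g h : s (g * h)%g = s g *m s h /\ t (g * h)%g = t g *m t h.
  have := piJ (g * h)%g; rewrite pirep.1.
  have -> : J^t* *m (pi g *m pi h) *m J =
      (J^t* *m pi g *m J) *m (J^t* *m pi h *m J).
    by rewrite !mulmxA -[_ *m J *m J^t*]mulmxA JJV mulmx1.
  rewrite !piJ mulmx_block !mulmx0 !mul0mx !addr0 !add0r.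
  by case/eq_block_mx.
have blockU g : s g *m (s g)^t* = 1%:M /\ t g *m (t g)^t* = 1%:M.
  have [sV tV] := blockM g g^-1%g; rewrite mulgV in sV tV.
  have := piJ g^-1%g; rewrite (unitary_representationV _ pirep).
  have -> : J^t* *m (pi g)^t* *m J = (J^t* *m pi g *m J)^t*.
    by rewrite !trmx_mul !map_mxM trmxCK mulmxA.
  rewrite piJ tr_block_mx map_block_mx !trmx0 => /eq_block_mx[-> _ _ ->].
  rewrite -sV -tV; have := piJ 1%g.
  rewrite (unitary_representation1 pirep) mulmx1 JVJ scalar_mx_block.
  by case/eq_block_mx.
by split; split=> [g h | g]; try apply/unitarymxP;
  first [have [? ?] := blockM g h | have [? ?] := blockU g].
Qed.

Lemma block_diag_group_ring_rep (f : integer_group_ring G) :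
  J^t* *m group_ring_rep pi f *m J =
  block_mx (group_ring_rep s f) 0 0 (group_ring_rep t f).
Proof.
rewrite mulmx_sumr mulmx_suml -sum_block_diag_mx; apply: eq_bigr => g _.
by rewrite -scalemxAr -scalemxAl piJ.
Qed.

Lemma block_diag_sq_norm_le (f : integer_group_ring G) (k : R) :
  (forall u, sq_norm u <= k * sq_norm (group_ring_rep s f *m u)) ->
  (forall u, sq_norm u <= k * sq_norm (group_ring_rep t f *m u)) ->
  forall v, sq_norm v <= k * sq_norm (group_ring_rep pi f *m v).
Proof.
move=> sk tk v; pose a := usubmx (J^t* *m v); pose b := dsubmx (J^t* *m v).
have -> : v = J *m col_mx a b by rewrite vsubmxK mulmxA JJV mul1mx.
have -> : group_ring_rep pi f *m (J *m col_mx a b) =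
    J *m col_mx (group_ring_rep s f *m a) (group_ring_rep t f *m b).
  have -> : col_mx (group_ring_rep s f *m a) (group_ring_rep t f *m b) =
      block_mx (group_ring_rep s f) 0 0 (group_ring_rep t f) *m col_mx a b.
    by rewrite mul_block_col !mul0mx addr0 add0r.
  by rewrite -block_diag_group_ring_rep !mulmxA JJV mul1mx.
by rewrite !(sq_norm_isometry _ JVJ) !sq_norm_col_mx mulrDr lerD.
Qed.

End BlockDiagonal.

(** The orthogonal complement of an invariant subspace is invariant, because the adjoint of [pi g]
    is [pi g^-1]. The columns of [J] are an orthonormal basis of the subspace followed by one of its
    complement; [J] has a rectangular type since [\rank U + q = n] is only a proved equation. *)
Lemma invariant_subspace_block_diag n (pi : G -> 'M[R[i]]_n) (U : 'M[R[i]]_n) :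
  unitary_representation pi -> (forall g, stablemx U (pi g)^T) ->
  exists (q : nat) (J : 'M[R[i]]_(n, \rank U + q))
      (s : G -> 'M[R[i]]_(\rank U)) (t : G -> 'M[R[i]]_q),
    [/\ (\rank U + q)%N = n, J *m J^t* = 1%:M, J^t* *m J = 1%:M &
      forall g, J^t* *m pi g *m J = block_mx (s g) 0 0 (t g)].
Proof.
move=> pirep Ust.
pose V := orthomx Num.Def.conjC (mx_of_hermitian (hermitian1mx _)) U.
pose B := schmidt (row_base U); pose D := schmidt (row_base V).
have BU : (B :=: U)%MS.
  exact: eqmx_trans (eqmx_schmidt_free (row_base_free _)) (eq_row_base _).
have DV : (D :=: V)%MS.
  exact: eqmx_trans (eqmx_schmidt_free (row_base_free _)) (eq_row_base _).
have DB : D *m B^t* = 0.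
  by apply/orthomx1P; rewrite DV orthomx_sym BU orthomx_sym.
have Bst g : B *m (pi g)^T *m D^t* = 0.
  have /submxP[S ->] : (B *m (pi g)^T <= B)%MS.
    by rewrite BU (eqmxMr _ BU); apply: Ust.
  by rewrite -mulmxA -[B]trmxCK -map_mxM -trmx_mul DB trmx0 map_mx0 mulmx0.
have Dst g : D *m (pi g)^T *m B^t* = 0.
  have := Bst g^-1%g; rewrite (unitary_representationV _ pirep).
  move=> /(congr1 (fun M : 'M_(_, _) => M^t*)).
  have -> : ((pi g)^t*)^T = ((pi g)^T)^t* by rewrite map_trmx.
  by rewrite !trmxC_mul !trmxCK mulmxA trmx0 map_mx0.
have rkUV : (\rank U + \rank V)%N = n by apply: add_rank_ortho.
pose W : 'M_(\rank U + \rank V, n) := col_mx B D.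
have Wu : W \is unitarymx := schmidt_complete_unitarymx U.
have WVW : W^t* *m W = 1%:M by rewrite -[_ *m _]mul1mx mulmxA mulmxKtV.
exists (\rank V), W^T, (fun g => (B *m (pi g)^T *m B^t*)^T),
  (fun g => (D *m (pi g)^T *m D^t*)^T); split=> // [||g].
- by rewrite -[RHS]trmx1 -WVW trmx_mul map_trmx.
- by rewrite -[RHS]trmx1 -(eqP Wu) trmx_mul map_trmx.
have -> : (W^T)^t* *m pi g *m W^T = (W *m (pi g)^T *m W^t*)^T.
  rewrite !trmx_mul [((pi g)^T)^T]trmxK mulmxA; congr (_ *m _ *m _).
  by apply/matrixP => i j; rewrite !mxE.
rewrite /W tr_col_mx map_row_mx mul_col_mx mul_col_row Bst Dst.
by rewrite tr_block_mx !trmx0.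
Qed.

(** Strong induction on the dimension: a reducible representation splits orthogonally into two
    smaller ones, and squared norms add, so [k] does not deteriorate. *)
Lemma irreducible_bound_unitary (f : integer_group_ring G) (k : R) :
  (forall n (pi : G -> 'M[R[i]]_n),
     unitary_representation pi -> irreducible pi ->
     forall v, sq_norm v <= k * sq_norm (group_ring_rep pi f *m v)) ->
  forall n (pi : G -> 'M[R[i]]_n), unitary_representation pi ->
    forall v, sq_norm v <= k * sq_norm (group_ring_rep pi f *m v).
Proof.
move=> irrk; elim/ltn_ind => n IHn pi pirep.
have [/irrk|redpi] := pselect (irreducible pi); first exact.
(* Dimension 0 fails to be irreducible without having a proper invariant subspace; there both norms
   are 0. *)
have [n0 | n_gt0] := posnP n.
  move=> v; rewrite /sq_norm /re_dot !big1 ?mulr0 // => i;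
    by have := ltn_ord i; rewrite {2}n0.
have [U Ust [U0 UT]] : exists2 U : 'M_n,
    forall g, stablemx U (pi g)^T & U != 0 /\ ~~ row_full U.
  apply: contrapT => noU; apply: redpi; split=> // U Ust.
  by apply: contrapT => /not_orP[/negP U0 /negP UT]; apply: noU; exists U.
have [q [J [s [t [rq JJV JVJ piJ]]]]] := invariant_subspace_block_diag pirep Ust.
have [srep trep] := block_diag_unitary_representation pirep JJV JVJ piJ.
have rU_lt : (\rank U < n)%N by rewrite ltn_neqAle rank_leq_col andbT.
have rU_gt : (0 < \rank U)%N by rewrite lt0n mxrank_eq0.
apply: (block_diag_sq_norm_le JJV JVJ piJ); apply: IHn => //.
by rewrite -rq -[ltnLHS]add0n ltn_add2r.
Qed.
End CompleteReducibility.

(** * Finite permutation representations *)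

Section FiniteActions.
Local Open Scope sesquilinear_scope.
Variables (R : realType) (G : groupType).

(* This is rho(f)v, that is, the convolution of v with f^*. *)
Definition convolution (f : integer_group_ring G) (v : G -> R) (h : G) : R :=
  \sum_(g <- finsupp f) (f g)%:~R * v (h * g)%g.

Definition right_action (T : Type) (a : T -> G -> T) : Prop :=
  (forall x, a x 1%g = x) /\ (forall x g h, a x (g * h)%g = a (a x g) h).

(** A form of residual finiteness: every finite subset of [G] embeds into a finite [G]-set by an
    orbit map. *)
Definition separated_by_finite_actions : Prop :=
  forall F : seq G, exists (T : finType) (a : T -> G -> T) (x0 : T),
    right_action a /\ {in F &, injective (a x0)}.

Section Permutation.
Variables (T : finType) (a : T -> G -> T).
Hypothesis act : right_action a.

(** On functions on [T] this is right translation, which turns a right action into a left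
    representation; [f] then acts as the analogue on [T] of [convolution]. *)
Definition action_rep (g : G) : 'M[R[i]]_#|T| :=
  \matrix_(i, j) (enum_val j == a (enum_val i) g)%:R.

Definition function_vector (x : T -> R) : 'cV[R[i]]_#|T| :=
  \col_i (x (enum_val i))%:C%C.

Lemma action_repE (p : nat) g (M : 'M[R[i]]_(#|T|, p)) i j :
  (action_rep g *m M) i j = M (enum_rank (a (enum_val i) g)) j.
Proof.
rewrite mxE (bigD1 (enum_rank (a (enum_val i) g))) //= big1 ?addr0.
  by rewrite mxE enum_rankK eqxx mul1r.
move=> k ne_k; rewrite mxE; case: eqP => [def_k|]; last by rewrite mul0r.
by case/eqP: ne_k; rewrite -def_k enum_valK.
Qed.

Lemma right_action_inj g : injective (a^~ g).
Proof.
by case: act => a1 aM x y /= /(congr1 (a^~ g^-1%g)); rewrite -!aM mulgV !a1.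
Qed.

Lemma action_rep_unitary : unitary_representation action_rep.
Proof.
split=> [g h | g].
  by apply/matrixP => i j; rewrite action_repE !mxE enum_rankK act.2.
apply/unitarymxP/matrixP => i j; rewrite action_repE !mxE enum_rankK.
rewrite rmorph_nat (inj_eq (@right_action_inj g)) (inj_eq enum_val_inj).
by rewrite eq_sym.
Qed.

Lemma sq_norm_function_vector (x : T -> R) :
  sq_norm (function_vector x) = \sum_A x A ^+ 2.
Proof.
rewrite (reindex (@enum_val T predT)) /=; last first.
  by apply: onW_bij; apply: enum_val_bij.
by apply: eq_bigr => i _; rewrite !mxE /= mulr0 addr0 expr2.
Qed.

Lemma group_ring_rep_function_vector (f : integer_group_ring G) (x : T -> R) :
  group_ring_rep action_rep f *m function_vector x =
  function_vector (fun A => \sum_(g <- finsupp f) (f g)%:~R * x (a A g)).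
Proof.
apply/colP => i; rewrite mulmx_suml summxE mxE rmorph_sum.
apply: eq_bigr => g _; rewrite -scalemxAl mxE action_repE mxE enum_rankK.
by rewrite complex_intr rmorphM.
Qed.

End Permutation.

(** Transport [v] to a finite [G]-set that is large enough for neither [v] nor [convolution f v] to
    overlap itself, and apply the bound for the permutation representation there. *)
Lemma separated_sq_sum_le (f : integer_group_ring G) (k : R) :
  separated_by_finite_actions -> 0 <= k ->
  (forall n (pi : G -> 'M[R[i]]_n), unitary_representation pi ->
     forall v, sq_norm v <= k * sq_norm (group_ring_rep pi f *m v)) ->
  forall (v : G -> R) (S F : seq G), uniq S ->
    (forall h, h \notin S -> v h = 0) ->
    (forall h g, g \in finsupp f -> (h * g)%g \in S -> h \in F) ->
  \sum_(h <- S) v h ^+ 2 <= k * \sum_(h <- F) convolution f v h ^+ 2.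
Proof.
move=> sepG k_ge0 bound v S F uniqS vS SF.
(* Injectivity is required on [S] and on all points where [convolution f v] evaluates [v] when
   computed on [F]. *)
have [T [a [x0 [act inj_a]]]] :=
  sepG (S ++ [seq (h * g)%g | h <- F, g <- finsupp f]).
pose phi := a x0.
have phiM h g : a (phi h) g = phi (h * g)%g by rewrite /phi act.2.
pose x A : R := \sum_(h <- S | phi h == A) v h.
have xE h : h \in S ++ [seq (h * g)%g | h <- F, g <- finsupp f] ->
    x (phi h) = v h.
  move=> hSF; have -> : x (phi h) = \sum_(h' <- S | h' == h) v h'.
    rewrite /x big_seq_cond [RHS]big_seq_cond; apply: eq_bigl => h'.
    case: (boolP (h' \in S)) => //= h'S.
    by apply/eqP/eqP => [/inj_a->|->] //; rewrite mem_cat h'S.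
  have [hS|hS] := boolP (h \in S).
    rewrite (big_rem h) //= eqxx big1_seq ?addr0 // => h' /andP[/eqP->].
    by rewrite mem_rem_uniqF.
  rewrite vS // big1_seq // => h'.
  by case/andP=> /eqP->; rewrite (negPf hS).
have sumE (I : seq G) (F' : G -> R) :
    \sum_A \sum_(h <- I | phi h == A) F' h = \sum_(h <- I) F' h.
  rewrite (exchange_big_dep predT) //=; apply: eq_bigr => h _.
  by rewrite (big_pred1 (phi h)) // => A; rewrite eq_sym.
have := bound _ _ (action_rep_unitary act) (function_vector x).
rewrite group_ring_rep_function_vector !sq_norm_function_vector.
pose y A := \sum_(g <- finsupp f) (f g)%:~R * x (a A g).
rewrite -[X in _ <= _ * X -> _]/(\sum_A y A ^+ 2).
have -> : \sum_A x A ^+ 2 = \sum_(h <- S) v h ^+ 2.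
  rewrite -[RHS]sumE; apply: eq_bigr => A _.
  rewrite expr2 {1}/x mulr_suml big_seq_cond [RHS]big_seq_cond.
  apply: eq_bigr => h /andP[hS /eqP <-].
  by rewrite xE ?expr2 // mem_cat hS.
move=> le_xy; apply: le_trans le_xy _; apply: ler_wpM2l => //.
rewrite -sumE; apply: ler_sum => A _.
have yE h : h \in F -> y (phi h) = convolution f v h.
  move=> hF; rewrite /y /convolution; apply: eq_big_seq => g gf.
  by rewrite phiM xE // mem_cat; apply/orP; right; apply/allpairsP; exists (h, g).
(* Over [phi] of [F] the value of [y] is a convolution value. Elsewhere it is 0: a point of [S]
   above [a A g], multiplied by [g^-1], would be a point of [F] above [A]. *)
have [/hasP[h hF /eqP def_A] | noA] := boolP (has (fun h => phi h == A) F).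
  rewrite (big_rem h) //= def_A eqxx -def_A yE // lerDl.
  by apply: sumr_ge0 => h' _; apply: sqr_ge0.
suff -> : y A = 0 by rewrite expr0n sumr_ge0 // => h _; apply: sqr_ge0.
rewrite /y big1_seq // => g /= gf; rewrite /x big1_seq ?mulr0 // => h.
case/andP=> /eqP def_h hS; case/negP: noA; apply/hasP.
exists (h * g^-1)%g; last first.
  by rewrite -phiM def_h -act.2 mulgV act.1.
by apply: SF gf _; rewrite mulgVK.
Qed.

End FiniteActions.

(* The modulus k + 2 exceeds all differences of entries of elements of F. *)
Lemma heisenberg_separated : separated_by_finite_actions heisenberg.
Proof.
move=> F.
pose k := (\sum_(x <- F) \sum_(y <- F) \sum_i \sum_j
  absz (heis_mx x i j - heis_mx y i j)%R)%N.
pose T : finType := 'M['Z_k.+2]_3.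
pose r (x : heisenberg) : T := map_mx intr (heis_mx x).
exists T, (fun A x => A *m r x), 1%:M; split; first split=> [A|A x y].
- by rewrite /r map_mx1 mulmx1.
- by rewrite /r map_mxM mulmxA.
move=> x y xF yF; rewrite !mul1mx => /matrixP rxy.
apply: val_inj; apply/matrixP => i j; apply/eqP; rewrite -subr_eq0.
have := rxy i j; rewrite !mxE => /eqP; rewrite -subr_eq0 -rmorphB /=.
have : (absz (heis_mx x i j - heis_mx y i j)%R <= k)%N.
  rewrite /k (big_rem x) //= (big_rem y) //= (bigD1 i) //= (bigD1 j) //=.
  by rewrite -!addnA leq_addr.
set d := heis_mx x i j - heis_mx y i j.
have absE (n : nat) : (n <= k)%N -> (n%:R : 'Z_k.+2) == 0 -> n = 0%N.
  by move=> nk /eqP/(congr1 val); rewrite /= Zp_nat /= modn_small // ltnS ltnW.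
case: d => n /= nk; first by move/(absE _ nk)->.
by rewrite NegzE rmorphN oppr_eq0 => /(absE _ nk).
Qed.

(** * Bounded kernel and polynomial growth *)

Lemma sumr_const_seq (V : nmodType) (T : Type) (s : seq T) (x : V) :
  \sum_(i <- s) x = x *+ size s.
Proof. by rewrite big_const_seq count_predT iter_addr addr0. Qed.

Lemma sum_uniq_le (R : numDomainType) (T : eqType) (s1 s2 : seq T) (u : T -> R) :
  (forall x, 0 <= u x) -> uniq s1 ->
  (forall x, x \in s1 -> u x != 0 -> x \in s2) ->
  \sum_(x <- s1) u x <= \sum_(x <- s2) u x.
Proof.
move=> u_ge0; elim: s1 s2 => [|x s1 IHs] s2 /=; first by rewrite big_nil sumr_ge0.
case/andP=> xs1 us1 s12; rewrite big_cons.
have [ux0 | ux] := eqVneq (u x) 0.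
  by rewrite ux0 add0r; apply: IHs => // y ys1; apply: s12; rewrite inE ys1 orbT.
have xs2 : x \in s2 by apply: s12; rewrite ?mem_head.
rewrite (big_rem x xs2) /= lerD2l; apply: IHs => // y ys1 uy.
have := s12 y; rewrite inE ys1 orbT => /(_ isT uy).
rewrite (perm_mem (perm_to_rem xs2)) inE => /orP[/eqP y_x|//].
by case/negP: xs1; rewrite -y_x.
Qed.

Lemma sq_sum_mul_le (R : rcfType) (T : eqType) (s : seq T) (c y : T -> R) :
  (\sum_(x <- s) c x * y x) ^+ 2 <=
    (\sum_(x <- s) `|c x|) ^+ 2 * \sum_(x <- s) y x ^+ 2.
Proof.
have Y_ge0 : 0 <= \sum_(x <- s) y x ^+ 2 by apply: sumr_ge0 => x _; apply: sqr_ge0.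
rewrite -(sqr_sqrtr Y_ge0) -exprMn -[leLHS]real_normK ?num_real //.
apply: lerXn2r; rewrite ?nnegrE ?mulr_ge0 ?sqrtr_ge0 ?sumr_ge0 //.
apply: le_trans (ler_norm_sum _ _ _) _; rewrite mulr_suml.
rewrite big_seq_cond [leRHS]big_seq_cond; apply: ler_sum => x /andP[xs _].
rewrite normrM ler_wpM2l // -sqrtr_sqr ler_wsqrtr // (big_rem x) //= lerDl.
by apply: sumr_ge0 => z _; apply: sqr_ge0.
Qed.

Lemma bernoulli_le (R : realDomainType) (e : R) n : 0 <= e ->
  1 + n%:R * e <= (1 + e) ^+ n.
Proof.
move=> e_ge0; elim: n => [|n IHn]; first by rewrite mul0r addr0 expr0.
rewrite exprS -nat1r; apply: le_trans (ler_wpM2l _ IHn); last by rewrite addr_ge0.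
have ne2 : 0 <= n%:R * e ^+ 2 by rewrite mulr_ge0 // sqr_ge0.
by nra.
Qed.

(** Take the exponent [n = m * p.+1]. By Bernoulli the left side is at least [(m * e) ^+ p.+1 * x],
    while the right side is at most [C * (m * p.+2) ^ p]. Cancelling [m ^ p] bounds a positive
    multiple of [m], which is absurd if [x > 0]. *)
Lemma exponential_polynomial (R : realType) (e x C : R) (p : nat) : 0 < e ->
  (forall n, (1 + e) ^+ n * x <= C * n.+1%:R ^+ p) -> x <= 0.
Proof.
move=> e_gt0 expC; rewrite leNgt; apply/negP => x_gt0.
pose K := C * (p.+2%:R) ^+ p.
have bound m : (0 < m)%N -> m%:R * (e ^+ p.+1 * x) <= K.
  move=> m_gt0; have mR_gt0 : 0 < m%:R :> R by rewrite ltr0n.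
  have C_ge0 : 0 <= C.
    have := expC 0%N; rewrite expr0 mul1r expr1n mulr1.
    by apply: le_trans; apply: ltW.
  rewrite -(ler_pM2l (exprn_gt0 p mR_gt0)).
  rewrite (_ : _ ^+ p * _ = (m%:R * e) ^+ p.+1 * x); last first.
    by rewrite exprMn !exprS; ring.
  have := expC (m * p.+1)%N; rewrite exprM => expCm.
  apply: (le_trans (y := ((1 + e) ^+ m) ^+ p.+1 * x)).
    apply: ler_wpM2r; first exact: ltW.
    apply: lerXn2r; rewrite ?nnegrE ?exprn_ge0 ?mulr_ge0 ?addr_ge0 1?ltW //.
    by apply: lt_le_trans (bernoulli_le _ (ltW e_gt0)); rewrite ltrDr.
  apply: le_trans expCm _; rewrite /K [leRHS]mulrCA ler_wpM2l // -exprMn.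
  apply: lerXn2r; rewrite ?nnegrE ?mulr_ge0 // -natrM ler_nat.
  by rewrite mulnS [(m * p.+2)%N]mulnS -addn1; lia.
have ex_gt0 : 0 < e ^+ p.+1 * x by rewrite mulr_gt0 // exprn_gt0.
have := bound (Num.bound `|K / (e ^+ p.+1 * x)|).+1 isT.
rewrite leNgt -ltr_pdivrMr // => /negP; apply.
apply: le_lt_trans (ler_norm _) _; apply: lt_le_trans (archi_boundP (normr_ge0 _)) _.
by rewrite ler_nat.
Qed.

Section Growth.
Variable G : groupType.

(** The sets [B r] stand for balls of radius [r]: only the effect of one multiplication by an
    element of [K] matters, so any convenient boxes may serve. *)
Definition polynomial_growth : Prop :=
  forall K : seq G, exists (B : nat -> seq G) (C p : nat),
    [/\ forall r, uniq (B r), 1%g \in B 0%N,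
        forall r h g, h \in B r -> g \in K -> (h * g)%g \in B r.+1 &
        forall r, (size (B r) <= C * r.+1 ^ p)%N].

Variables (R : realType) (f : integer_group_ring G).

Lemma bounded_kernel_at1 (k b : R) (w : G -> R) :
  polynomial_growth -> 0 <= k ->
  (forall (v : G -> R) (S F : seq G), uniq S ->
    (forall h, h \notin S -> v h = 0) ->
    (forall h g, g \in finsupp f -> (h * g)%g \in S -> h \in F) ->
    \sum_(h <- S) v h ^+ 2 <= k * \sum_(h <- F) convolution f v h ^+ 2) ->
  (forall h, `|w h| <= b) -> (forall h, convolution f w h = 0) -> w 1%g = 0.
Proof.
move=> growG k_ge0 lower w_le fw0.
(* The unit makes the boxes nested; the support of [f] and its inverses let a box absorb a step
   [h * g] in either direction. *)
have [B [C [p [uniqB B1 BK sizeB]]]] :=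
  growG (1%g :: finsupp f ++ [seq g^-1%g | g <- finsupp f]).
have BS r h : h \in B r -> h \in B r.+1.
  by move=> hB; rewrite -[h]mulg1 BK // mem_head.
have BM r h g : h \in B r -> g \in finsupp f -> (h * g)%g \in B r.+1.
  by move=> hB gf; rewrite BK // inE mem_cat gf orbT.
have BV r h g : (h * g)%g \in B r -> g \in finsupp f -> h \in B r.+1.
  move=> hB gf; rewrite -[h](mulgK g) BK // inE mem_cat.
  by rewrite [_ \in map _ _]map_f ?orbT.
pose a r : R := \sum_(h <- B r) w h ^+ 2.
have aS r : a r <= a r.+1.
  by apply: sum_uniq_le => [x|//|x /BS->]; first exact: sqr_ge0.
pose L : R := (\sum_(g <- finsupp f) `|(f g)%:~R|) ^+ 2.
have L_ge0 : 0 <= L by apply: sqr_ge0.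
pose D : R := k * (L * (size (finsupp f))%:R).
have D_ge0 : 0 <= D by rewrite mulr_ge0 // mulr_ge0.
have a_D r : a r.+2 <= D * (a r.+2 - a r).
  (* rho(f)v vanishes on B r.+1, so only values of w on the shell             *)
  (* B r.+2 \ B r contribute to it; u is w ^+ 2 restricted to this shell.     *)
  pose v h := if h \in B r.+2 then w h else 0.
  pose u h := if (h \in B r.+2) && (h \notin B r) then w h ^+ 2 else 0.
  have u_ge0 h : 0 <= u h by rewrite /u; case: ifP => // _; apply: sqr_ge0.
  have vE : a r.+2 = \sum_(h <- B r.+2) v h ^+ 2.
    by apply: eq_big_seq => h hB; rewrite /v hB.
  have sum_u : \sum_(h <- B r.+2) u h = a r.+2 - a r.
    apply/eqP; rewrite eq_sym subr_eq; apply/eqP.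
    have -> : a r = \sum_(h <- B r.+2) (if h \in B r then w h ^+ 2 else 0).
      rewrite -big_mkcond -[RHS]big_filter; apply: perm_big.
      apply: uniq_perm; rewrite ?filter_uniq // => h; rewrite mem_filter.
      by case: (boolP (h \in B r)) => //= /BS/BS->.
    rewrite -big_split /=; apply: eq_big_seq => h hB; rewrite /u hB /=.
    by case: (h \in B r); rewrite /= ?add0r ?addr0.
  rewrite {1}vE; apply: le_trans (lower v (B r.+2) (B r.+3) _ _ _) _ => //.
  - by move=> h /negPf hB; rewrite /v hB.
  - by move=> h g gf /BV; apply.
  rewrite -mulrA ler_wpM2l // -mulrA -sum_u.
  have conv_le h : convolution f v h ^+ 2 <=
      L * \sum_(g <- finsupp f) u (h * g)%g.
    have [hB | hB] := boolP (h \in B r.+1).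
      have -> : convolution f v h = 0.
        rewrite -(fw0 h); apply: eq_big_seq => g gf.
        by rewrite /v BM.
      by rewrite expr0n mulr_ge0 // sumr_ge0.
    apply: le_trans (sq_sum_mul_le _ _ _) _; rewrite ler_wpM2l //.
    rewrite big_seq_cond [leRHS]big_seq_cond; apply: ler_sum => g /andP[gf _].
    rewrite /v /u; case: ifP => hgB /=; last by rewrite expr0n.
    by case: ifPn => // /negPn/BV/(_ gf) hB'; rewrite hB' in hB.
  (* After exchanging the sums, each [g] contributes at most the total of [u], since right
     translation by [g] is injective and [u] vanishes off [B r.+2]. *)
  apply: le_trans (ler_sum _ (fun h _ => conv_le h)) _.
  rewrite -mulr_sumr ler_wpM2l // exchange_big /= mulr_natl -sumr_const_seq.
  apply: ler_sum => g _; rewrite -(big_map (fun h => h * g)%g predT u) /=.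
  apply: sum_uniq_le => //; first by rewrite map_inj_uniq //; apply: mulIg.
  by move=> x _; rewrite /u; case: (x \in B r.+2); rewrite ?eqxx.
pose e : R := (D + 1)^-1.
have D1_gt0 : 0 < D + 1 by rewrite ltr_wpDl.
have e_gt0 : 0 < e by rewrite invr_gt0.
have a_ge0 r : 0 <= a r by apply: sumr_ge0 => h _; apply: sqr_ge0.
(* From [a r <= a r.+2] and [a_D], [a r] is at most [(D + 1) * (a r.+2 - a r)]. *)
have a_growth r : (1 + e) * a r <= a r.+2.
  have := a_D r; have := aS r; have := aS r.+1; have := a_ge0 r => a0 a1 a2 a3.
  rewrite mulrDl mul1r -lerBrDl /e mulrC ler_pdivrMr //.
  by rewrite mulrDr mulr1 [_ * D]mulrC; lra.
have a_exp n : (1 + e) ^+ n * w 1%g ^+ 2 <= a n.*2.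
  elim: n => [|n IHn].
    rewrite expr0 mul1r /a (big_rem 1%g) //= lerDl.
    by apply: sumr_ge0 => h _; apply: sqr_ge0.
  rewrite exprS -mulrA doubleS; apply: le_trans (a_growth _).
  by rewrite ler_wpM2l // addr_ge0 // ltW.
have a_poly r : a r <= b ^+ 2 * (C * r.+1 ^ p)%:R.
  apply: (le_trans (y := b ^+ 2 * (size (B r))%:R)); last first.
    by rewrite ler_wpM2l ?sqr_ge0 // ler_nat.
  rewrite mulr_natr -sumr_const_seq; apply: ler_sum => h _.
  rewrite -real_normK ?num_real //; apply: lerXn2r; rewrite ?nnegrE //.
  exact: le_trans (w_le h).
have w2 : w 1%g ^+ 2 <= 0.
  (* The growth factor is gained every two radii, so [a] is taken at [n.*2]; the factor [2 ^ p]
     comes from [n.*2.+1 <= 2 * n.+1]. *)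
  apply: (@exponential_polynomial _ e _ (b ^+ 2 * (C * 2 ^ p)%:R) p e_gt0) => n.
  apply: le_trans (a_exp n) _; apply: le_trans (a_poly _) _.
  rewrite -mulrA -natrX -natrM ler_wpM2l ?sqr_ge0 // ler_nat -mulnA -expnMn.
  rewrite leq_mul2l; apply/orP; right; case: (p) => // q.
  by rewrite leq_exp2r //; lia.
by apply/eqP; rewrite -sqrf_eq0 eq_le w2 sqr_ge0.
Qed.

End Growth.

(** * Polynomial growth of the Heisenberg group *)

Section HeisenbergGrowth.
Implicit Types (x y : heisenberg) (M r n : nat) (a b c : int).

Definition heis_x x : int := heis_mx x 0 1.
Definition heis_y x : int := heis_mx x 1 2.
Definition heis_z x : int := heis_mx x 0 2.

Lemma heisenberg_eq x y :
  heis_x x = heis_x y -> heis_y x = heis_y y -> heis_z x = heis_z y -> x = y.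
Proof.
move=> xy1 xy2 xy3; apply: val_inj; apply/matrixP => i j.
have [le_ji|lt_ij] := leqP j i.
  by rewrite !(is_unipotent_upperP _ (heis_mxP _)).
move: i j lt_ij => [[|[|[|i]]] Hi] [[|[|[|j]]] Hj] //= _.
- by move: xy1; rewrite /heis_x; congr (_ = _);
    congr (fun_of_matrix _ _ _); apply: val_inj.
- by move: xy3; rewrite /heis_z; congr (_ = _);
    congr (fun_of_matrix _ _ _); apply: val_inj.
by move: xy2; rewrite /heis_y; congr (_ = _);
  congr (fun_of_matrix _ _ _); apply: val_inj.
Qed.

Lemma heisenberg_mulE x y : [/\ heis_x (x * y)%g = heis_x x + heis_x y,
  heis_y (x * y)%g = heis_y x + heis_y y &
  heis_z (x * y)%g = heis_z x + heis_x x * heis_y y + heis_z y].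
Proof.
have xE := is_unipotent_upperP _ (heis_mxP x).
have yE := is_unipotent_upperP _ (heis_mxP y).
have [o0 o1 o2] : [/\ ord0 = 0 :> 'I_3, lift ord0 ord0 = 1 :> 'I_3 &
    lift ord0 (lift ord0 ord0) = 2 :> 'I_3] by split; apply: val_inj.
by rewrite /heis_x /heis_y /heis_z; split;
  rewrite [LHS]mxE !big_ord_recl big_ord0 o0 o1 o2;
  rewrite ?[x 0 0]xE ?[x 1 0]xE ?[x 1 1]xE ?[y 1 1]yE ?[y 2 1]yE ?[y 2 2]yE //=; ring.
Qed.

Definition unipotent_mx a b c : 'M[int]_3 :=
  \matrix_(i, j) if (j <= i)%N then (i == j)%:R
    else if i == 1 then b else if j == 1 then a else c.

Lemma unipotent_mxP a b c : is_unipotent_upper (unipotent_mx a b c).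
Proof. by apply/is_unipotent_upperP => i j le_ji; rewrite mxE le_ji. Qed.

Definition heis_of_coords a b c : heisenberg := Heisenberg (unipotent_mxP a b c).

Lemma heis_of_coordsK x : heis_of_coords (heis_x x) (heis_y x) (heis_z x) = x.
Proof. by apply: heisenberg_eq; rewrite /heis_x /heis_y /heis_z /= mxE. Qed.

Definition int_interval n : seq int := [seq i%:Z - n%:Z | i <- iota 0 n.*2.+1].

Lemma mem_int_interval n a : (a \in int_interval n) = (`|a| <= n%:Z).
Proof.
apply/mapP/idP => [[i + ->] | an]; first by rewrite mem_iota; lia.
by exists (absz (a + n%:Z)); rewrite ?mem_iota; lia.
Qed.

(* The z-coordinate of a product has a term x * y, hence a quadratic range. *)
Definition heis_box M r : seq heisenberg :=
  undup [seq heis_of_coords t.1.1 t.1.2 t.2 | t <-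
    [seq (s, c) | s <- [seq (a, b) | a <- int_interval (r * M),
                                     b <- int_interval (r * M)],
      c <- int_interval (r * r * (M * M))]].

Lemma mem_heis_box M r x : (x \in heis_box M r) =
  [&& `|heis_x x| <= (r * M)%N%:Z, `|heis_y x| <= (r * M)%N%:Z &
    `|heis_z x| <= (r * r * (M * M))%N%:Z].
Proof.
rewrite mem_undup -!mem_int_interval; apply/mapP/and3P => [[t] | [xI yI zI]].
  case/allpairsP=> [[s c] [sI cI ->]] ->.
  by case/allpairsP: sI => [[a b] [aI bI /= ->]]; rewrite /heis_x /heis_y /heis_z /= !mxE.
exists (heis_x x, heis_y x, heis_z x); last by rewrite /= heis_of_coordsK.
apply/allpairsP; exists ((heis_x x, heis_y x), heis_z x); split=> //.
by apply/allpairsP; exists (heis_x x, heis_y x).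
Qed.

Lemma size_heis_box M r :
  (size (heis_box M r) <= (2 * M + 1) ^ 4 * r.+1 ^ 4)%N.
Proof.
apply: leq_trans (size_undup _) _; rewrite size_map !size_allpairs !size_map !size_iota.
rewrite -expnMn; set m := ((2 * M + 1) * r.+1)%N.
have m1 : ((r * M).*2.+1 <= m)%N by rewrite /m; nia.
have m2 : ((r * r * (M * M)).*2.+1 <= m * m)%N by rewrite /m; nia.
by rewrite (_ : (m ^ 4 = m * m * (m * m))%N) ?leq_mul // !expnS expn0 muln1 !mulnA.
Qed.

Lemma heisenberg_polynomial_growth : polynomial_growth heisenberg.
Proof.
move=> K; pose M := (\sum_(x <- K)
  (absz (heis_x x) + absz (heis_y x) + absz (heis_z x))%N)%N.
exists (heis_box M), ((2 * M + 1) ^ 4)%N, 4; split; last exact: size_heis_box.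
- by move=> r; apply: undup_uniq.
- by rewrite mem_heis_box /heis_x /heis_y /heis_z !mxE.
move=> r h g; rewrite !mem_heis_box => /and3P[h1 h2 h3] gK.
have gM : (absz (heis_x g) + absz (heis_y g) + absz (heis_z g) <= M)%N.
  by rewrite /M (big_rem g) //= leq_addr.
have [-> -> ->] := heisenberg_mulE h g.
(* The new z-coordinate is at most [r * r * (M * M) + r * M * M + M] in absolute value, which fits
   into the box of radius [r.+1]. *)
have h12 : `|heis_x h * heis_y g| <= (r * M * M)%N%:Z.
  by rewrite normrM PoszM ler_pM //; lia.
have M2 : (M <= M * M)%N by nia.
by apply/and3P; split; nia.
Qed.

End HeisenbergGrowth.

(** * Expansiveness and the bounded kernel *)

Section TorusProjection.
Local Open Scope classical_set_scope.
Local Open Scope ring_scope.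
Variable R : realType.

Definition torus_proj (t : R) : torus R := \pi_({ideal_quot (@integers R)})%qT t.

Lemma torus_proj_is_zmod_morphism : zmod_morphism torus_proj.
Proof.
move=> x y; rewrite /torus_proj.
exact: (@pi_is_zmod_morphism _ _ _ (@Quotient.quot R (@integers R))).
Qed.

HB.instance Definition _ :=
  GRing.isZmodMorphism.Build R (torus R) torus_proj torus_proj_is_zmod_morphism.

Lemma torus_proj_eq (x y : R) : (torus_proj x == torus_proj y) = (x - y \is a Num.int).
Proof.
rewrite -[RHS]/(x - y \in @integers R) Quotient.idealrBE.
by apply/eqP/eqP.
Qed.

Lemma torus_proj_eq0 (x : R) : (torus_proj x == 0) = (x \is a Num.int).
Proof. by rewrite -(raddf0 torus_proj) torus_proj_eq subr0. Qed.

Lemma torus_proj_continuous : continuous torus_proj.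
Proof. exact: pi_continuous. Qed.

Definition torus_ball (e : R) : set (torus R) :=
  [set torus_proj t | t in [set t | `|t| < e]].

Lemma open_torus_ball (e : R) : open (torus_ball e).
Proof.
rewrite /open /= /quotient_open openE => s /= [t te ts].
rewrite /interior; apply/nbhs_ballP; exists (e - `|t|); first by rewrite /= subr_gt0.
move=> s' /= ss'; exists (t + (s' - s)).
  rewrite /=; apply: le_lt_trans (ler_normD _ _) _; rewrite -ltrBrDl distrC.
  exact: ss'.
apply/eqP; rewrite raddfD /= ts raddfB /=.
by rewrite addrC subrK.
Qed.

End TorusProjection.

Section Expansiveness.
Local Open Scope classical_set_scope.
Local Open Scope ring_scope.
Variables (R : realType) (G : groupType) (f : integer_group_ring G).
Local Notation X := (principal_space R f).

Lemma principal_space_proj_continuous (h : G) :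
  continuous (fun x : X => val x h : torus R).
Proof.
move=> x; apply: (@continuous_comp X {ptws G -> torus R} (torus R) val (fun y => y h)).
  exact: (@initial_continuous X {ptws G -> torus R} val).
exact: (@proj_continuous _ (fun _ : G => torus R) h).
Qed.

Lemma cvg_principal_space (F : set_system X) (x : X) : Filter F ->
  (forall h, (fun y : X => val y h : torus R) @ F --> (val x h : torus R)) ->
  F --> x.
Proof.
move=> FF cvgF U [_ [[V oV <-] Vx VU]].
apply: filterS VU _; rewrite -/(val @^-1` V).
have : val @ F --> (val x : {ptws G -> torus R}).
  apply/cvg_sup => h W [_ [[W' oW' <-] W'x W'W]].
  have := cvgF h W' (open_nbhs_nbhs (conj oW' W'x)).
  exact: (@filterS _ F FF _ _ (fun y W'y => W'W (val y) W'y)).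
by move=> /(_ V (open_nbhs_nbhs (conj oV Vx))).
Qed.

Lemma torus_proj_convolution (w : G -> R) h :
  torus_proj (convolution f w h) =
  \sum_(g <- finsupp f) torus_proj (w (h * g)%g) *~ f g.
Proof. by rewrite raddf_sum; apply: eq_bigr => g _; rewrite mulrzl raddfMz. Qed.

Lemma principal_set_torus_proj (w : G -> R) :
  (forall h, convolution f w h = 0) ->
  ((fun h => torus_proj (w h)) : {ptws G -> torus R}) \in @principal_set R G f.
Proof. by move=> fw0; apply/mem_set => h; rewrite -torus_proj_convolution fw0 raddf0. Qed.

Variable d : X -> X -> R.
Hypotheses (d_compatible : compatible_metric d) (d_inv : translation_invariant d).

Lemma invariant_metricB x y : d x y = d 0 (y - x).
Proof. by rewrite -[RHS](d_inv _ _ x) add0r subrK. Qed.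

(** If all translates of [x] and [y] stay close, then [y - x] lifts to a real function [w] with
    small values. Its convolution with [f] is integer-valued and smaller than 1, hence 0, so [w] is
    0 and [x = y]. *)
Lemma kernel_trivial_expansive :
  (forall (w : G -> R) (b : R), (forall h, `|w h| <= b) ->
     (forall h, convolution f w h = 0) -> forall h, w h = 0) ->
  expansive (@principal_action R G f) d.
Proof.
move=> ker0; pose L : R := \sum_(g <- finsupp f) `|(f g)%:~R|.
have L1_gt0 : 0 < 1 + L by rewrite ltr_wpDr // sumr_ge0.
(* Chosen so that [L * del < 1]. *)
pose del := (1 + L)^-1; have del_gt0 : 0 < del by rewrite invr_gt0.
pose A := [set x : X | torus_ball del (val x 1%g)].
have nA : nbhs (0 : X) A.
  apply: (@principal_space_proj_continuous 1%g 0).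
  apply: open_nbhs_nbhs; split; first exact: open_torus_ball.
  by exists 0; rewrite /= ?normr0 // raddf0.
have [e e_gt0 eA] := (cmetric_nbhs d_compatible _ _).1 nA.
exists (e / 2); first by rewrite divr_gt0.
move=> x y neq_xy; rewrite ltNge; apply/negP => sup_le; apply: neq_xy.
(* Shifting by [h^-1] brings the coordinate at [h] to the unit, where [A] controls it. *)
have small h : exists t : R, `|t| < del /\ torus_proj t = val y h - val x h.
  have : A (principal_action h^-1%g y - principal_action h^-1%g x).
    apply: eA; rewrite /= -invariant_metricB.
    have : d (principal_action h^-1%g x) (principal_action h^-1%g y) <= e / 2.
      by rewrite -lee_fin; apply: le_trans sup_le; apply: ereal_sup_ubound; exists h^-1%g.
    by move=> /le_lt_trans; apply; rewrite ltr_pdivrMr // ltr_pMr // ltr1n.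
  rewrite -[A _]/(torus_ball del (val y (h^-1^-1 * 1)%g - val x (h^-1^-1 * 1)%g)).
  by rewrite invgK mulg1 => -[t /= t_lt tE]; exists t.
have [w wP] := choice small.
have w0 h : w h = 0.
  apply: (ker0 w del) h => h; first by have [/ltW] := wP h.
  have : torus_proj (convolution f w h) = 0.
    rewrite torus_proj_convolution; under eq_bigr => g _ do
      (have [_ ->] := wP (h * g)%g; rewrite mulrzBl).
    have /set_mem xX := valP x; have /set_mem yX := valP y.
    by rewrite sumrB yX xX subr0.
  move/eqP; rewrite torus_proj_eq0 => /norm_intr_ge1 int1.
  apply/eqP; apply: contraT => /int1; rewrite leNgt => /negP[].
  apply: (le_lt_trans (y := L * del)).
    apply: le_trans (ler_norm_sum _ _ _) _; rewrite mulr_suml.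
    apply: ler_sum => g _; rewrite normrM ler_wpM2l //.
    by have [/ltW] := wP (h * g)%g.
  by rewrite ltr_pdivrMr // mul1r ltrDr.
apply: val_inj; apply/funext => h.
by have [_ +] := wP h; rewrite w0 raddf0 => /esym/eqP; rewrite subr_eq0 => /eqP.
Qed.

(** If [w] is nonzero at the unit, small multiples of [w] project to nonzero points of X_f whose
    coordinates tend to 0 uniformly. Their translates then tend to 0 as well, however the
    translating elements are chosen, which contradicts expansiveness. *)
Lemma expansive_kernel_at1 (w : G -> R) (b : R) :
  expansive (@principal_action R G f) d ->
  (forall h, `|w h| <= b) -> (forall h, convolution f w h = 0) -> w 1%g = 0.
Proof.
case=> e e_gt0 expd w_le fw0; apply/eqP; apply: contraT => w1.
have b_ge0 : 0 <= b by apply: le_trans (w_le 1%g).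
pose t n : R := (n.+1%:R * (1 + b))^-1.
have t_gt0 n : 0 < t n by rewrite invr_gt0 mulr_gt0 // ltr_wpDr.
have tw_lt n h : `|t n * w h| < n.+1%:R^-1.
  rewrite normrM gtr0_norm // /t invfM -mulrA gtr_pMr ?invr_gt0 //.
  rewrite mulrC ltr_pdivrMr ?ltr_wpDr // mul1r.
  by apply: le_lt_trans (w_le h) _; rewrite ltrDr.
pose tw n h := t n * w h.
have ftw n h : convolution f (tw n) h = 0.
  rewrite -(mulr0 (t n)) -(fw0 h) mulr_sumr.
  by apply: eq_bigr => g _; rewrite mulrCA.
pose x n : X := Sub ((fun h => torus_proj (tw n h)) : {ptws G -> torus R})
  (principal_set_torus_proj (ftw n)).
have x_neq0 n : 0 <> x n.
  move=> /(congr1 (fun z : X => val z 1%g)) /= /esym /eqP.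
  rewrite torus_proj_eq0 => /norm_intr_ge1 int1.
  have := tw_lt n 1%g; rewrite ltNge => /negP; apply.
  apply: (le_trans (y := 1)); first by rewrite invf_le1 // ler1n.
  by apply: int1; rewrite /tw mulf_neq0 // gt_eqF.
have far n : exists h, e <= d 0 (principal_action h (x n)).
  have := expd 0 (x n) (x_neq0 n); move=> /ereal_sup_gt[_ [h _ <-]].
  rewrite lte_fin => /ltW eh; exists h; apply: le_trans eh _.
  by rewrite invariant_metricB [X in _ - X](_ : _ = 0) ?subr0 //; apply: val_inj.
have [g gP] := choice far.
have : (fun n => principal_action (g n) (x n)) @ \oo --> (0 : X).
  apply: cvg_principal_space => h.
  pose y n := tw n ((g n)^-1 * h)%g.
  have y0 : y @ \oo --> (0 : R).
    apply/cvgrPdist_lt => eps eps_gt0.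
    near=> n; rewrite sub0r normrN; apply: lt_trans (tw_lt _ _) _.
    near: n; exact: near_infty_natSinv_lt (PosNum eps_gt0).
  rewrite -[val 0 h]/(0 : torus R) -(raddf0 (@torus_proj R)).
  exact: (cvg_comp y (@torus_proj R) y0 (@torus_proj_continuous R 0)).
have nb : nbhs (0 : X) [set z | d 0 z < e].
  by apply/(cmetric_nbhs d_compatible); exists e.
move=> /(_ _ nb) [n _ /(_ n (leqnn n))] /=.
by rewrite ltNge gP.
Unshelve. all: by end_near. Qed.

End Expansiveness.

(** * Bounded kernel elements from approximate ones *)

Section ApproximateKernel.
Local Open Scope classical_set_scope.
Local Open Scope ring_scope.
Variables (R : realType) (G : groupType) (f : integer_group_ring G).

(** A cluster point exists by Tychonoff in the product of intervals [-1, 1]. Since [f] has finite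
    support, each value of the convolution is continuous for pointwise convergence, so the
    conditions pass to the limit. *)
Lemma approximate_kernel_limit (w : nat -> G -> R) :
  (forall n h, `|w n h| <= 1) -> (forall n, w n 1%g = 1) ->
  (forall n h, `|convolution f (w n) h| <= n.+1%:R^-1) ->
  exists u : G -> R, [/\ forall h, `|u h| <= 1, u 1%g = 1 &
    forall h, convolution f u h = 0].
Proof.
move=> w_le w1 fw_le.
have : compact [set u : {ptws G -> R} | forall h, [set` `[(-1 : R), 1]] (u h)].
  exact: (@tychonoff G (fun=> R) (fun=> [set` `[(-1 : R), 1]])
    (fun=> @segment_compact R (-1) 1)).
move=> /(_ ((w : nat -> {ptws G -> R}) @ \oo) _).
case; first by exists 0%N => // n _ h /=; rewrite in_itv /= -ler_norml.
move=> u [u_le]; rewrite cluster_cvgE => -[F FF [Fu wF]].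
have evalF h : (fun v : {ptws G -> R} => v h) @ F --> u h.
  exact: (cvg_comp _ _ Fu (@proj_continuous _ (fun=> R) h u)).
exists u; split=> [h||h].
- by have := u_le h; rewrite /= in_itv /= ler_norml.
  apply: (@closed_cvg _ R F _ (fun v : {ptws G -> R} => v 1%g)
    (fun x : R => x = 1) (@closed_eq R 1) _ (u 1%g) (evalF 1%g)).
  by apply: wF; exists 0%N => // n _ /=.
have conv_cvg : (fun v : {ptws G -> R} => convolution f v h) @ F --> convolution f u h.
  apply: (cvg_big (x0 := 0) (op := +%R)) => [|g _]; first exact: add_continuous.
  by apply: cvgMl_tmp; apply: evalF.
apply/eqP; rewrite -normr_le0; apply/ler_addgt0Pl => eps eps_gt0; rewrite addr0.
have small : \forall n \near \oo, `|convolution f (w n) h| <= eps.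
  near=> n; apply: le_trans (fw_le n h) _; apply: ltW.
  by near: n; exact: near_infty_natSinv_lt (PosNum eps_gt0).
apply: (@closed_cvg _ R F _ (fun v : {ptws G -> R} => `|convolution f v h|)
  (fun x : R => x <= eps) (@closed_le _ eps) _ _ (cvg_norm conv_cvg)).
exact: wF small.
Unshelve. all: by end_near. Qed.

Lemma approximate_kernel_matrix_coefficient n (pi : G -> 'M[R[i]]_n)
    (v : 'cV[R[i]]_n) (c : R) :
  unitary_representation pi -> 0 < c ->
  c ^+ 2 * sq_norm (group_ring_rep pi f *m v) < sq_norm v ->
  exists w : G -> R, [/\ forall h, `|w h| <= 1, w 1%g = 1 &
    forall h, `|convolution f w h| <= c^-1].
Proof.
move=> pirep c_gt0 small_v.
have v_gt0 : 0 < sq_norm v.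
  by apply: le_lt_trans small_v; rewrite mulr_ge0 ?sqr_ge0 ?sq_norm_ge0.
exists (fun h => re_dot v (pi h *m v) / sq_norm v); split=> [h||h].
- rewrite normrM normfV (gtr0_norm v_gt0) ler_pdivrMr // mul1r.
  apply: le_trans (re_dot_le _ _ ltr01) _.
  by rewrite sq_norm_unitary ?pirep.2 // invr1 !mul1r; lra.
- by rewrite (unitary_representation1 pirep) mul1mx divff // gt_eqF.
have -> : convolution f (fun h => re_dot v (pi h *m v) / sq_norm v) h =
    re_dot v (pi h *m (group_ring_rep pi f *m v)) / sq_norm v.
  rewrite /convolution mulmx_suml mulmx_sumr re_dot_sumr mulr_suml.
  apply: eq_bigr => g _.
  by rewrite -scalemxAl -scalemxAr re_dotMr mulrA pirep.1 mulmxA.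
rewrite normrM normfV (gtr0_norm v_gt0) ler_pdivrMr //.
have ci_gt0 : 0 < c^-1 by rewrite invr_gt0.
(* The weight [c^-1] balances the two terms, as [pi(f)v] is shorter than [v] by a factor of at least
   [c]. *)
apply: le_trans (re_dot_le _ _ ci_gt0) _.
rewrite sq_norm_unitary ?pirep.2 // invrK.
have : c * sq_norm (group_ring_rep pi f *m v) <= c^-1 * sq_norm v.
  by rewrite ler_pdivlMl // mulrA -expr2 ltW.
by lra.
Qed.

End ApproximateKernel.

Theorem proposition4p4 (R : realType) (f : integer_group_ring heisenberg)
    (d : principal_space R f -> principal_space R f -> R)
    (d_compatible : compatible_metric d)
    (d_invariant : translation_invariant d) :
  expansive (@principal_action R heisenberg f) d <->
  exists2 c : R, 0 < c &
    forall (n : nat) (pi : heisenberg -> 'M[R[i]]_n),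
      unitary_representation pi -> irreducible pi ->
      group_ring_rep pi f \in unitmx /\
      operator_norm (invmx (group_ring_rep pi f)) <= c.
Proof.
split=> [expd | [c c_gt0 bound]].
  apply: contrapT => unbounded.
  have /choice[w wP] : forall n : nat, exists w : heisenberg -> R,
      [/\ forall h, `|w h| <= 1, w 1%g = 1 &
          forall h, `|convolution f w h| <= n.+1%:R^-1].
    move=> n; apply: contrapT => no_w; apply: unbounded.
    exists n.+1%:R => // m pi pirep _; apply/operator_norm_invmxP => // v.
    rewrite leNgt; apply/negP => small_v; apply: no_w.
    exact: approximate_kernel_matrix_coefficient pirep _ small_v.
  have [u [u_le u1 fu0]] : exists u : heisenberg -> R,
      [/\ forall h, `|u h| <= 1, u 1%g = 1 & forall h, convolution f u h = 0].
    by apply: (approximate_kernel_limit (w := w)) => n; have [] := wP n.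
  have := expansive_kernel_at1 d_compatible d_invariant expd u_le fu0.
  by rewrite u1 => /eqP; rewrite oner_eq0.
apply: kernel_trivial_expansive => // w b w_le fw0 h.
(* Left translation commutes with [convolution f], so it suffices to treat the value at the unit. *)
pose w' x := w (h * x)%g.
rewrite -[h]mulg1 -/(w' 1%g).
have c2_ge0 : 0 <= c ^+ 2 by apply: sqr_ge0.
apply: (@bounded_kernel_at1 _ R f (c ^+ 2) b) => //.
- exact: heisenberg_polynomial_growth.
- apply: separated_sq_sum_le heisenberg_separated c2_ge0 _.
  apply: irreducible_bound_unitary => n pi pirep irr.
  by apply/operator_norm_invmxP => //; apply: bound.
- by move=> x; apply: w_le.
move=> x; rewrite -(fw0 (h * x)%g); apply: eq_bigr => g _.
by rewrite /w' mulgA.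
Qed.
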